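(* Let $G$ be a finite connected graph with two distinct marked vertices $X_0$ and $Y_0$. Let $X_i$ be a simple random walk on $G$ started at $X_0$ and stopped when hitting $Y_0$, and let $\mathrm{PATH}$ be the subgraph of $G$ consisting of all the edges the random walk crossed before being stopped at $Y_0$. For a vertex $x$ let $v(x)$ be the probability that a simple random walk on $G$ started at $x$ hits $X_0$ before $Y_0$. Let $s=\max\{v(y): y\sim Y_0\}$ and $d=\max\{\deg(x): x\ne Y_0\}$. Then $$E\bigl(C_{\mathrm{eff}}(X_0\leftrightarrow Y_0;\mathrm{PATH})\bigr)\le\frac{12\log(d)}{\log(1/s)}.$$
   Context: $C_{\mathrm{eff}}(v\leftrightarrow u;H)$ denotes the effective conductance between $v$ and $u$ in the network $H$; in $\mathrm{PATH}$ every edge has unit conductance. $y\sim Y_0$ means $y$ is adjacent to $Y_0$. When $s=1$ (i.e. $X_0\sim Y_0$) the right-hand side is interpreted as $+\infty$. *)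

(* Defs.v *)
From HB Require Import structures.
From mathcomp Require Import all_boot all_order all_algebra.
From mathcomp Require Import all_classical all_reals all_analysis.
Import Order.TTheory GRing.Theory Num.Theory.
Import numFieldNormedType.Exports.

Set Implicit Arguments.
Unset Strict Implicit.
Unset Printing Implicit Defensive.

Local Open Scope classical_set_scope.
Local Open Scope ring_scope.

(* A finite simple graph is a symmetric irreflexive relation on a finType. *)
Definition simple_graph (V : finType) (e : rel V) : Prop :=
  symmetric e /\ irreflexive e.

Definition connected_graph (V : finType) (e : rel V) : Prop :=
  forall x y, connect e x y.

Definition deg (V : finType) (e : rel V) (x : V) : nat := #|[set y | e x y]%SET|.

Definition srw_step (R : realType) (V : finType) (e : rel V) (x y : V) : R :=
  if e x y then (deg e x)%:R^-1 else 0.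

(* The Markov property is the multiplicative form of
   P(X_(n+1) = y | X_0 = p_0, ..., X_n = p_n) = srw_step p_n y,
   so that no conditioning on a null event occurs. *)
Definition is_srw (d : measure_display) (Om : measurableType d) (R : realType)
    (P : probability Om R) (V : finType) (e : rel V) (x : V)
    (X : nat -> Om -> V) : Prop :=
  [/\ forall n y, measurable (X n @^-1` [set y]),
      P [set w | X 0%N w = x] = 1%E &
      forall (n : nat) (p : nat -> V) (y : V),
        P [set w | (forall i, (i <= n)%N -> X i w = p i) /\ X n.+1 w = y] =
        (P [set w | forall i, (i <= n)%N -> X i w = p i] *
          (srw_step R e (p n) y)%:E)%E].

(* A realization of simple random walk started at x, on some probability
   space. *)
Record srw (R : realType) (V : finType) (e : rel V) (x : V) := Srw {
  srw_display : measure_display;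
  srw_space : measurableType srw_display;
  srw_prob : probability srw_space R;
  srw_walk : nat -> srw_space -> V;
  srwP : is_srw srw_prob e x srw_walk }.

Definition hits_before (V Om : Type) (X : nat -> Om -> V) (a b : V) : set Om :=
  [set w | exists n, X n w = a /\ forall m, (m <= n)%N -> X m w <> b].

Definition hit_prob (R : realType) (V : finType) (e : rel V)
    (W : forall x, srw R e x) (a b x : V) : R :=
  fine (srw_prob (W x) (hits_before (@srw_walk R V e x (W x)) a b)).

(* PATH as an adjacency relation on V: the edges crossed strictly before the
   first visit to b.  Vertices outside of PATH are kept as isolated vertices,
   which does not affect conductances. *)
Definition path_graph (V : finType) (Om : Type) (X : nat -> Om -> V) (b : V)
    (w : Om) : rel V :=
  fun u v => `[< exists i, (forall j, (j <= i)%N -> X j w <> b) /\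
      ((X i w = u /\ X i.+1 w = v) \/ (X i w = v /\ X i.+1 w = u)) >].

(* Unit voltage between a and b in the network whose edges are those of h, all
   with unit conductance (Kirchhoff's node law off a and b). *)
Definition unit_voltage (R : realType) (V : finType) (h : rel V) (a b : V)
    (f : V -> R) : Prop :=
  [/\ f a = 1, f b = 0 &
      forall x, x != a -> x != b -> \sum_(y | h x y) (f x - f y) = 0].

(* The current leaving a under a unit voltage between a and b.  When h is
   symmetric and a != b, a unit voltage exists, and although it is not unique
   on components of h that avoid a and b, the current does not depend on it;
   the current is 0 when h does not connect a to b. *)
Definition Ceff (R : realType) (V : finType) (h : rel V) (a b : V) : R :=
  let f := xget (fun=> 0) [set f : V -> R | unit_voltage h a b f] in
  \sum_(y | h a y) (f a - f y).

(* Main.v *)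
Require Import Defs.
From HB Require Import structures.
From mathcomp Require Import all_boot all_order all_algebra.
From mathcomp Require Import all_classical all_reals all_analysis.
From mathcomp Require Import measurable_realfun ring lra.
Import Order.TTheory GRing.Theory Num.Theory.
Import numFieldNormedType.Exports.
Local Open Scope classical_set_scope.
Local Open Scope ring_scope.
Set Implicit Arguments.
Unset Strict Implicit.
Unset Printing Implicit Defensive.

(** By the Dirichlet principle, the conductance of PATH is at most the energy
on PATH of any function equal to [1] at [X0] and to [0] at [Y0]
([Ceff_bounds]).  The function used is the logarithm of the voltage [v] of
the whole graph, cut off at the level [s] and rescaled:
[f = 1 - ln (max s v) / ln s].  Since [v <= s] at the neighbours of [Y0], [f]
vanishes there and the edges at [Y0] carry no energy.

It remains to bound the expectation of
[\sum_(xy edge of PATH) (f x - f y)^2].  The probability that an edge [xy]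
belongs to PATH is at most the expected number of its crossings, in either
direction, before [Y0] is reached, which is [G x / deg x + G y / deg y] with
[G] the Green function of the walk killed at [Y0].  By reversibility
[G x / deg x] is a voltage that vanishes at [Y0] and emits unit current, so it
equals [v x / C] where [C] is the current of [v] out of [X0].  To avoid the
question of whether [G] is finite, only its truncations [green b n] to the
first [n] steps are used: they are subharmonic off [X0] and [Y0], and the
comparison with [v] becomes an inequality given by the minimum principle
([le_voltage], [voltage_current_le1]).

Let [xy] be an edge with [v y <= v x] and [s < v x].  Harmonicity of [v] at
[y] gives [v x <= d * v y], and for ratios in [[1, d]] the logarithm satisfies
[(v x + v y) * (ln (v x) - ln (v y)) <= 12 * ln d * (v x - v y)]
([ln_sub_le]).  Hence the edge contributes at most
[12 * ln d / ln (1 / s) * (f x - f y) * (v x - v y) / C] ([edge_energy_le]),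
and summation by parts turns the sum over all edges of
[(f x - f y) * (v x - v y)] into [f X0 * C = C] ([weighted_energy_le]),
because [v] is harmonic off [X0] and [Y0] and [f Y0 = 0].

That [v] is harmonic follows by writing it as the limit of the probabilities
of reaching [X0] within [k] steps, which satisfy a one-step recursion by the
Markov property ([pr_cylinder_hit], [cvg_reach], [hit_prob_harmonic]).  That
[s] is positive is the strong minimum principle: if [v] vanished at all
neighbours of [Y0] it would be superharmonic off [X0] and attain its minimum
[0] at [Y0], so it would vanish at [X0]. *)

(** * Dirichlet principle and minimum principle on a finite network *)

Section Network.
Context {R : realType} {V : finType}.
Implicit Types (h : rel V) (f g v : V -> R).

(** The net current out of [x]; with this sign convention a superharmonic
function has nonnegative Laplacian. *)
Definition laplacian h g (x : V) : R := \sum_(y | h x y) (g x - g y).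

Lemma laplacianB h f g x :
  laplacian h (fun z => f z - g z) x = laplacian h f x - laplacian h g x.
Proof. by rewrite /laplacian -sumrB; apply: eq_bigr => y _; ring. Qed.

Lemma laplacianZ h c g x :
  laplacian h (fun z => c * g z) x = c * laplacian h g x.
Proof. by rewrite /laplacian mulr_sumr; apply: eq_bigr => y _; ring. Qed.

Lemma sum_rel_swap h (F : V -> V -> R) : symmetric h ->
  \sum_x \sum_(y | h x y) F x y = \sum_x \sum_(y | h x y) F y x.
Proof.
move=> hs; rewrite (exchange_big_dep predT) //=.
by apply: eq_bigr => x _; apply: eq_bigl => y; rewrite hs.
Qed.

Lemma summation_by_parts h f g : symmetric h ->
  \sum_x \sum_(y | h x y) (f x - f y) * (g x - g y) =
  2 * \sum_x f x * laplacian h g x.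
Proof.
move=> hs.
have -> : \sum_x f x * laplacian h g x =
    \sum_x \sum_(y | h x y) f x * (g x - g y).
  by apply: eq_bigr => x _; rewrite mulr_sumr.
rewrite mulr_natl mulr2n [X in _ = _ + X]sum_rel_swap // -big_split /=.
apply: eq_bigr => x _; rewrite -big_split /=.
by apply: eq_bigr => y _; ring.
Qed.

Lemma sum_laplacian h f g a b : a != b -> f a = 1 -> f b = 0 ->
    (forall x, x != a -> x != b -> laplacian h g x = 0) ->
  \sum_x f x * laplacian h g x = laplacian h g a.
Proof.
move=> ab fa fb gh; rewrite (bigD1 a) //= fa mul1r big1 ?addr0 // => x xa.
by have [->|xb] := eqVneq x b; [rewrite fb mul0r | rewrite gh // mulr0].
Qed.

(** The energy of [f] minus that of a unit voltage [g] is the energy of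
[f - g], because summation by parts evaluates both the energy of [g] and the
mixed term as the current of [g] out of [a].  When there is no unit voltage,
[Ceff] is computed from the zero function and is [0]. *)
Lemma Ceff_bounds h a b f : symmetric h -> a != b -> f a = 1 -> f b = 0 ->
  0 <= Ceff R h a b <= 2^-1 * \sum_x \sum_(y | h x y) (f x - f y) ^+ 2.
Proof.
move=> hs ab fa fb; rewrite /Ceff.
have sq0 (F : V -> R) : 0 <= \sum_x \sum_(y | h x y) (F x - F y) ^+ 2.
  by apply: sumr_ge0 => x _; apply: sumr_ge0 => y _; rewrite sqr_ge0.
case: xgetP => [g _ /= [ga gb gh]|_]; last first.
  by rewrite big1 ?lexx ?mulr_ge0 ?invr_ge0 // => x _; rewrite subrr.
have eg : \sum_x \sum_(y | h x y) (g x - g y) ^+ 2 = 2 * laplacian h g a.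
  rewrite -(sum_laplacian ab ga gb gh) -summation_by_parts //.
have efg : \sum_x \sum_(y | h x y) (f x - f y) * (g x - g y)
    = 2 * laplacian h g a.
  by rewrite -(sum_laplacian ab fa fb gh) -summation_by_parts.
have := sq0 (fun x => f x - g x).
have -> : \sum_x \sum_(y | h x y) (f x - g x - (f y - g y)) ^+ 2 =
   \sum_x \sum_(y | h x y) (f x - f y) ^+ 2
   - 2 * \sum_x \sum_(y | h x y) (f x - f y) * (g x - g y)
   + \sum_x \sum_(y | h x y) (g x - g y) ^+ 2.
  rewrite mulr_sumr -sumrB -big_split /=; apply: eq_bigr => x _.
  rewrite mulr_sumr -sumrB -big_split /=; apply: eq_bigr => y _; ring.
have := sq0 g; rewrite eg efg -/(laplacian h g a); lra.
Qed.

Definition superharmonic_off h (A : {pred V}) g :=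
  forall x, x \notin A -> 0 <= laplacian h g x.

(** Strong minimum principle: at a minimum off [A] all neighbours take the
minimal value too, and connectedness carries that value to [a0]. *)
Lemma minimum_attained h (A : {pred V}) g a0 z : connected_graph h ->
    a0 \in A -> superharmonic_off h A g -> (forall y, g z <= g y) ->
  exists2 a, a \in A & g a = g z.
Proof.
move=> hc a0A gs gmin; apply: contrapT => noA.
have nA y : g y = g z -> y \notin A.
  by move=> gy; apply/negP => yA; apply: noA; exists y.
have step x y : g x = g z -> h x y -> g y = g z.
  move=> gx hxy; have := gs x (nA x gx).
  rewrite /laplacian (bigD1 y) //=.
  have : \sum_(i | h x i && (i != y)) (g x - g i) <= 0.
    by apply: sumr_le0 => i _; rewrite gx subr_le0.
  rewrite gx; have := gmin y; lra.
have /connectP[p hp a0p] := hc z a0.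
have gp x : g x = g z -> path h x p -> g (last x p) = g z.
  elim: p x {hp a0p} => //= y p IH x gx /andP[hxy hp].
  exact: IH (step _ _ gx hxy) hp.
by have := nA _ (gp z erefl hp); rewrite -a0p a0A.
Qed.

Lemma minimum_principle h (A : {pred V}) g a0 : connected_graph h ->
    a0 \in A -> superharmonic_off h A g ->
    (forall x, x \in A -> 0 <= g x) ->
  forall x, 0 <= g x.
Proof.
move=> hc a0A gs gA x.
pose m := [arg min_(z < x) g z]%O.
have mmin z : g m <= g z by rewrite /m; case: arg_minP => // i _; apply.
have [a aA ga] := minimum_attained hc a0A gs mmin.
by rewrite (le_trans _ (mmin x)) // -ga gA.
Qed.

End Network.

(** * A logarithmic inequality for bounded ratios *)

Section LogInequality.
Context {R : realType}.

Lemma half_le_ln2 : 2^-1 <= ln 2 :> R.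
Proof.
have : ln (1 + (- 2^-1)) <= - 2^-1 :> R by apply: le_ln1Dx; lra.
have -> : 1 + (- 2^-1) = 2^-1 :> R by field.
by rewrite lnV ?posrE // lerN2.
Qed.

(** With [r = a / b] the claim is [(r + 1) * ln r <= 12 * ln n * (r - 1)].  For
[r >= 2] it follows from [r + 1 <= 3 * (r - 1)]; for [r <= 2], from
[ln r <= r - 1] and [r + 1 <= 3], the constant being absorbed by
[ln 2 >= 1 / 2].  For [n = 1] both sides vanish, as [a = b]. *)
Lemma ln_sub_le (a b : R) (n : nat) : 0 < b -> b <= a -> a <= n%:R * b ->
  (a + b) * (ln a - ln b) <= 12 * ln (n%:R : R) * (a - b).
Proof.
move=> b0 ba anb; have a0 : 0 < a by exact: lt_le_trans ba.
have rb : a = a / b * b by rewrite divfK // gt_eqF.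
rewrite -ln_div ?posrE //.
move: rb; set r := a / b => rb.
have r1 : 1 <= r by rewrite /r ler_pdivlMr // mul1r.
have rn : r <= n%:R by rewrite /r ler_pdivrMr.
suff : (r + 1) * ln r <= 12 * ln (n%:R : R) * (r - 1).
  move=> /(ler_wpM2r (ltW b0)); rewrite rb; lra.
have n0 : (0 < n)%N by rewrite -(ltr0n R); apply: lt_le_trans rn; lra.
have [n1|n2] := leqP n 1.
  have -> : r = 1.
    by apply/eqP; rewrite eq_le r1 (le_trans rn) // lern1.
  by rewrite ln1 subrr !mulr0.
have ln2n : ln 2 <= ln (n%:R : R) by rewrite ler_ln ?posrE ?ltr0n // ler_nat.
have lnr : ln r <= ln (n%:R : R) by rewrite ler_ln ?posrE ?ltr0n //; lra.
have lnr0 : 0 <= ln r by exact: ln_ge0.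
have := half_le_ln2.
have [r2|/ltW r2] := leP r 2.
  have : ln r <= r - 1.
    by have := @le_ln1Dx R (r - 1); rewrite (addrC 1) subrK; apply; lra.
  move=> h1 h2; apply: (@le_trans _ _ (3 * (r - 1))); first by nra.
  by apply: ler_wpM2r; lra.
move=> _; apply: (@le_trans _ _ ((r + 1) * ln (n%:R : R))).
  by apply: ler_wpM2l => //; lra.
rewrite mulrAC; apply: ler_wpM2r; lra.
Qed.

End LogInequality.

(** * Energy of the truncated logarithm of the voltage *)

Section Energy.
Context {R : realType} {V : finType}.
Variables (e : rel V) (a b : V) (v : V -> R) (s : R) (n : nat).
Hypotheses (es : symmetric e) (ab : a != b).
Hypotheses (va : v a = 1) (vb : v b = 0).
Hypotheses (v01 : forall x, 0 <= v x <= 1).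
Hypothesis vh : forall x, x != a -> x != b -> laplacian e v x = 0.
Hypotheses (s01 : 0 < s < 1).
Hypothesis sP : forall y, e b y -> v y <= s.
Hypothesis nP : forall x, x != b -> (deg e x <= n)%N.

Definition log_truncation (x : V) : R := 1 - ln (Num.max s (v x)) / ln s.
Let f := log_truncation.

Let s0 : 0 < s. Proof. by case/andP: s01. Qed.
Let lns : ln s < 0. Proof. by apply: ln_lt0. Qed.

Lemma log_truncation_source : f a = 1.
Proof.
rewrite /f /log_truncation va; case/andP: s01 => _ /ltW s1.
by rewrite max_r // ln1 mul0r subr0.
Qed.

Lemma log_truncation_sink : f b = 0.
Proof.
by rewrite /f /log_truncation vb max_l ?(ltW s0) // divff ?subrr // lt_eqF.
Qed.

(** At [y <> a] the voltage is an average, over at most [n] neighbours, of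
nonnegative values among which is [v x]; at [a] it is maximal. *)
Lemma voltage_le_deg_neighbor x y : y != b -> e x y -> v x <= n%:R * v y.
Proof.
move=> yb exy; have /andP[vx0 vx1] := v01 x.
have eyx : e y x by rewrite es.
have [->|ya] := eqVneq y a.
  rewrite va mulr1; apply: le_trans vx1 _; rewrite ler1n.
  apply: leq_trans (nP yb); rewrite card_gt0; apply/set0Pn; exists x.
  by rewrite inE.
have := vh ya yb; rewrite /laplacian sumrB sumr_const => /eqP.
rewrite subr_eq0 => /eqP hy.
apply: (@le_trans _ _ (v y *+ deg e y)).
  rewrite /deg cardsE hy (bigD1 x) //= lerDl; apply: sumr_ge0 => z _.
  by case/andP: (v01 z).
rewrite -[leLHS]mulr_natl ler_wpM2r //; first by case/andP: (v01 y).
by rewrite ler_nat nP.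
Qed.

(** Below the level [s] both sides vanish.  Above it the edge avoids [b], so the
ratio of the voltages is at most [n] and [ln_sub_le] trades one factor
[f x - f y] for [v x - v y]. *)
Lemma edge_energy_le x y : e x y ->
  (v x + v y) * (f x - f y) ^+ 2 <=
  12 * ln (n%:R : R) / ln (1 / s) * ((f x - f y) * (v x - v y)).
Proof.
wlog yx : x y / v y <= v x.
  move=> H exy; have [|/ltW xy] := leP (v y) (v x); first by move/H; apply.
  have := H y x xy; rewrite es exy => /(_ isT).
  rewrite (addrC (v y)) -(opprB (f x)) -(opprB (v x)) sqrrN mulrNN; exact.
move=> exy; have [vxs|svx] := leP (v x) s.
  rewrite /f /log_truncation !max_l ?(le_trans yx) // subrr.
  by rewrite expr0n /= mul0r !mulr0.
have yb : y != b.
  by apply: contraTneq svx => yb; rewrite -leNgt sP // es -yb.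
have vx0 : 0 < v x by exact: lt_trans svx.
have vxy := voltage_le_deg_neighbor yb exy.
have vy0 : 0 < v y.
  have /andP[+ _] := v01 y; rewrite le_eqVlt => /predU1P[vy|//].
  by move: vxy; rewrite -vy mulr0 leNgt vx0.
have := ln_sub_le vy0 yx vxy.
have my0 : 0 < Num.max s (v y) by rewrite lt_max s0.
have : ln (v y) <= ln (Num.max s (v y)).
  by rewrite ler_ln ?posrE // le_max lexx orbT.
have : ln (Num.max s (v y)) <= ln (v x).
  by rewrite ler_ln ?posrE // ge_max (ltW svx).
rewrite div1r lnV ?posrE // /f /log_truncation (max_r (ltW svx)).
set lm := ln _; set lx := ln (v x); set ly := ln (v y); set ln_ := ln n%:R.
move=> h1 h2 h3.
have -> : 1 - lx / ln s - (1 - lm / ln s) = (lx - lm) / (- ln s).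
  by field; rewrite lt_eqF.
set l := - ln s; have l0 : 0 < l by rewrite oppr_gt0.
have -> : (v x + v y) * ((lx - lm) / l) ^+ 2 =
          (v x + v y) * (lx - lm) * ((lx - lm) / l ^+ 2).
  by field; rewrite gt_eqF.
have -> : 12 * ln_ / l * ((lx - lm) / l * (v x - v y)) =
          12 * ln_ * (v x - v y) * ((lx - lm) / l ^+ 2).
  by field; rewrite gt_eqF.
apply: ler_wpM2r; first by rewrite divr_ge0 ?subr_ge0 // exprn_ge0 // ltW.
apply: le_trans h3; apply: ler_wpM2l; first by rewrite addr_ge0 ?ltW.
by rewrite lerD2l lerN2.
Qed.

(** Symmetrising the weight produces [v x + v y]; after [edge_energy_le] the sum
is the mixed energy of [f] and [v], which is the current of [v] out of [a]. *)
Lemma weighted_energy_le :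
  \sum_x \sum_(y | e x y) v x * (f x - f y) ^+ 2 <=
  12 * ln (n%:R : R) / ln (1 / s) * laplacian e v a.
Proof.
rewrite -(sum_laplacian ab log_truncation_source log_truncation_sink vh).
rewrite -(ler_pM2l (ltr0n R 2)) mulrCA -/f -summation_by_parts // [leRHS]mulr_sumr.
(* one of the two copies is reindexed by reversing the edges *)
rewrite [leLHS]mulr_natl mulr2n [X in _ + X <= _]sum_rel_swap // -big_split /=.
apply: ler_sum => x _; rewrite mulr_sumr -big_split /=.
apply: ler_sum => y exy; apply: le_trans (edge_energy_le exy).
by rewrite mulrDl -(opprB (f x)) sqrrN.
Qed.

Section Comparison.
Variable U : V -> R.
Hypotheses (ec : connected_graph e) (U0 : forall x, 0 <= U x) (Ub : U b = 0).
Hypothesis Uh : forall x, x != b -> laplacian e U x <= (x == a)%:R.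

(** [U a * v - U] is superharmonic off [a] and [b] and vanishes at both. *)
Lemma le_voltage x : U x <= U a * v x.
Proof.
rewrite -subr_ge0.
apply: (minimum_principle (A := pred2 a b) (a0 := a)
  (g := fun x => U a * v x - U x) ec) => [|y|y].
- by rewrite inE eqxx.
- rewrite !inE negb_or => /andP[ya yb].
  have := Uh yb; rewrite (negbTE ya) laplacianB laplacianZ vh // mulr0 => Uy.
  by rewrite sub0r oppr_ge0.
- by rewrite !inE => /orP[] /eqP ->; rewrite ?va ?vb ?Ub ?mulr1 ?mulr0 subrr.
Qed.

(** [U] lies below [U a * v] with equality at [a], so it sends out of [a] at
least the current of [U a * v]. *)
Lemma voltage_current_le1 : U a * laplacian e v a <= 1.
Proof.
apply: (@le_trans _ _ (laplacian e U a)); last first.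
  by have := Uh ab; rewrite eqxx.
rewrite /laplacian mulr_sumr; apply: ler_sum => y _.
by rewrite mulrBr va mulr1 lerD2l lerN2 le_voltage.
Qed.

Lemma occupation_energy_le :
  \sum_x \sum_(y | e x y) U x * (f x - f y) ^+ 2 <=
  12 * ln (n%:R : R) / ln (1 / s).
Proof.
have K0 : 0 <= 12 * ln (n%:R : R) / ln (1 / s).
  rewrite divr_ge0 ?mulr_ge0 //; last by rewrite div1r lnV ?posrE // oppr_ge0 ltW.
  by case: (n) => [|m]; [rewrite ln0|rewrite ln_ge0 // ler1n].
apply: (@le_trans _ _ (U a * \sum_x \sum_(y | e x y) v x * (f x - f y) ^+ 2)).
  rewrite mulr_sumr; apply: ler_sum => x _; rewrite mulr_sumr.
  apply: ler_sum => y _; rewrite mulrA ler_wpM2r ?sqr_ge0 //.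
  exact: le_voltage.
apply: le_trans (ler_wpM2l (U0 a) weighted_energy_le) _.
rewrite mulrCA -[leRHS]mulr1 ler_wpM2l //.
exact: voltage_current_le1.
Qed.

End Comparison.
End Energy.

(** * Real-valued probabilities of events *)

Section RealProbability.
Context {d : measure_display} {Om : measurableType d} {R : realType}.
Variable P : probability Om R.
Implicit Types A B : set Om.

Definition pr A : R := fine (P A).

Lemma prE A : measurable A -> P A = (pr A)%:E.
Proof. by move=> mA; rewrite /pr fineK // fin_num_measure. Qed.

Lemma pr_ge0 A : 0 <= pr A.
Proof. exact: fine_ge0. Qed.

Lemma pr_set0 : pr set0 = 0.
Proof. by rewrite /pr measure0. Qed.

Lemma pr_full A : P A = 1%E -> pr A = 1.
Proof. by rewrite /pr => ->. Qed.

Lemma le_pr A B : measurable A -> measurable B -> A `<=` B -> pr A <= pr B.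
Proof.
move=> mA mB AB; rewrite -lee_fin -!prE //.
by apply: le_measure => //; rewrite inE.
Qed.

Lemma pr_le1 A : measurable A -> pr A <= 1.
Proof. by move=> mA; rewrite -lee_fin -prE // probability_le1. Qed.

Lemma pr_fibers (T : finType) (Z : Om -> T) A :
    (forall t, measurable (Z @^-1` [set t])) -> measurable A ->
  pr A = \sum_t pr (A `&` Z @^-1` [set t]).
Proof.
move=> mZ mA; apply: EFin_inj.
have mAZ t : measurable (A `&` Z @^-1` [set t]) by exact: measurableI.
rewrite -prE // -sumEFin.
have AE : A = \bigcup_(t in [set: T]) (A `&` Z @^-1` [set t]).
  by apply/seteqP; split => [w Aw|w [t _ []] //]; exists (Z w).
rewrite {1}AE measure_fin_bigcup //; last 2 first.
- exact: finite_finset.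
- by move=> t u _ _ [w [[_ /= <-] [_ /= <-]]].
rewrite fsbig_finite; last exact: finite_finset.
rewrite big_uniq ?finmap.fset_uniq //=.
apply: eq_big => [t|t _]; last by rewrite prE.
by rewrite in_fset_set ?in_setT //; exact: finite_finset.
Qed.

Lemma pr_setI_full A B : measurable A -> measurable B -> P B = 1%E ->
  pr (A `&` B) = pr A.
Proof.
move=> mA mB B1; congr fine.
have -> : P A = (P (A `\` B) + P (A `&` B))%E by exact: measureDI.
suff -> : P (A `\` B) = 0%E by rewrite add0e.
apply/eqP; rewrite eq_le measure_ge0 andbT.
have <- : P (~` B) = 0%E by rewrite probability_setC // B1 subee.
apply: le_measure; rewrite ?inE; first exact: measurableD.
- exact: measurableC.
- by move=> w [].
Qed.

End RealProbability.

(** * Crossings of edges and the killed Green function *)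

Section Walk.
Context {d : measure_display} {Om : measurableType d} {R : realType}.
Variables (P : probability Om R) (V : finType) (e : rel V) (x0 : V).
Variable X : nat -> Om -> V.
Hypothesis HX : is_srw P e x0 X.
Local Notation step := (srw_step R e).
Local Notation pr := (pr P).

Let mX n y : measurable [set w | X n w = y].
Proof. by have [mX _ _] := HX; exact: mX. Qed.

Lemma measurable_constraints n (S : nat -> set V) :
  measurable [set w | forall i, (i <= n)%N -> S i (X i w)].
Proof.
have -> : [set w | forall i, (i <= n)%N -> S i (X i w)] =
    \bigcap_(i in [set i | (i <= n)%N])
      \bigcup_(y in S i) [set w | X i w = y].
  apply/seteqP; split => w /= H i /= ilen; first by exists (X i w) => //; exact: H.
  by have [y Sy /= ->] := H i ilen.
apply: bigcap_measurableType => i _.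
by apply: fin_bigcup_measurable => //; exact: finite_finset.
Qed.

Lemma pr_start y : y != x0 -> pr [set w | X 0%N w = y] = 0.
Proof.
move=> yx; have [_ X0 _] := HX.
rewrite -(pr_setI_full (mX _ _) (mX 0%N x0) X0).
rewrite (_ : _ `&` _ = set0) ?pr_set0 //.
apply/seteqP; split => // w [/= -> xy].
by rewrite xy eqxx in yx.
Qed.

Definition cylinder n (p : nat -> V) : set Om :=
  [set w | forall i, (i <= n)%N -> X i w = p i].

Lemma measurable_cylinder n p : measurable (cylinder n p).
Proof. exact: (measurable_constraints n (fun i => [set p i])). Qed.

Lemma pr_cylinder_step n p y :
  pr (cylinder n p `&` [set w | X n.+1 w = y]) =
  pr (cylinder n p) * step (p n) y.
Proof.
have [_ _ mk] := HX; have := mk n p y.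
rewrite -/(cylinder n p `&` [set w | X n.+1 w = y]) -/(cylinder n p).
have mc := measurable_cylinder n p.
by rewrite (prE P (measurableI _ _ mc (mX n.+1 y))) (prE P mc) => -[].
Qed.

(** The walk killed at [b] has state [z] at time [n]. *)
Definition avoid b n z : set Om :=
  [set w | forall i, (i <= n)%N -> X i w != b] `&` [set w | X n w = z].

Lemma measurable_avoid b n z : measurable (avoid b n z).
Proof.
apply: measurableI => //.
exact: (measurable_constraints n (fun i => [set y | y != b])).
Qed.

(** The Markov property is assumed only for complete histories; [avoid b n z]
is the finite union of the histories up to time [n] that it allows. *)
Lemma pr_avoid_step b n z y :
  pr (avoid b n z `&` [set w | X n.+1 w = y]) = pr (avoid b n z) * step z y.
Proof.
pose Z w := [ffun i : 'I_n.+1 => X i w].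
have ZE (t : {ffun 'I_n.+1 -> V}) :
    Z @^-1` [set t] = cylinder n (fun i => t (inord i)).
  apply/seteqP; split => [w /= <- i ilen|w H /=].
    by rewrite ffunE inordK.
  by apply/ffunP => i; rewrite ffunE H ?inord_val // -ltnS.
have mZ t : measurable (Z @^-1` [set t]).
  by rewrite ZE; exact: measurable_cylinder.
have mA := measurable_avoid b n z.
rewrite (pr_fibers P mZ mA) (pr_fibers P mZ (measurableI _ _ mA (mX _ _))).
rewrite mulr_suml; apply: eq_bigr => t _.
pose p i := t (inord i).
have pn w : (Z @^-1` [set t]) w -> forall i, (i <= n)%N -> X i w = p i.
  by rewrite ZE.
case: (boolP ([forall i : 'I_n.+1, p i != b] && (p n == z))).
  move=> /andP[/forallP pb /eqP pz].
  have sub : Z @^-1` [set t] `<=` avoid b n z.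
    move=> w /pn H; split; last by rewrite /= H.
    move=> i ilen; rewrite H //.
    by have := pb (inord i); rewrite inordK.
  by rewrite setIAC (setIidr sub) ZE -pz pr_cylinder_step.
move=> np; have AZ0 : avoid b n z `&` Z @^-1` [set t] = set0.
  apply/seteqP; split => // w [[/= Hb Hz] /pn H]; case/negP: np.
  rewrite -H // Hz eqxx andbT; apply/forallP => i.
  by rewrite -H ?Hb // -ltnS.
by rewrite setIAC !AZ0 set0I pr_set0 mul0r.
Qed.

Lemma pr_avoid0_le b z : pr (avoid b 0 z) <= (z == x0)%:R.
Proof.
have [->|zx] := eqVneq z x0; first exact/pr_le1/measurable_avoid.
apply: (@le_trans _ _ (pr [set w | X 0%N w = z])); last by rewrite pr_start.
apply: le_pr => //; first exact: measurable_avoid.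
by move=> w [].
Qed.

Lemma pr_avoid_sink b n : pr (avoid b n b) = 0.
Proof.
rewrite (_ : avoid b n b = set0) ?pr_set0 //; apply/seteqP; split => // w.
by move=> [/= /(_ n (leqnn n)) /eqP Xb].
Qed.

Lemma pr_avoidS b n y : y != b ->
  pr (avoid b n.+1 y) = \sum_z pr (avoid b n z) * step z y.
Proof.
move=> yb; rewrite (pr_fibers P (fun z => mX n z) (measurable_avoid b n.+1 y)).
apply: eq_bigr => z _; rewrite -pr_avoid_step; congr pr.
apply/seteqP; split => w /= [].
  by move=> [H Xy] Xz; split => //; split => // i /leqW; exact: H.
move=> [H Xz] Xy; split => //; split => // i.
by rewrite leq_eqVlt => /predU1P[->|]; [rewrite Xy|rewrite ltnS; exact: H].
Qed.

(** The Green function of the walk killed at [b], cut off at time [n] and divided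
by the degree, which by reversibility makes it subharmonic in [z] off [x0]
and [b]. *)
Definition green b n z : R := (\sum_(i < n) pr (avoid b i z)) / (deg e z)%:R.

Lemma green_ge0 b n z : 0 <= green b n z.
Proof. by rewrite divr_ge0 // sumr_ge0 // => i _; exact: pr_ge0. Qed.

Lemma green_sink b n : green b n b = 0.
Proof. by rewrite /green big1 ?mul0r // => i _; exact: pr_avoid_sink. Qed.

(** Summing the forward equation [pr_avoidS] over time expresses the occupation
up to time [n + 1] by that up to time [n]; the time-[0] term is the source at
[x0], and the inequality comes from dropping the visits at time [n]. *)
Lemma laplacian_green b n y : symmetric e -> y != b ->
  laplacian e (green b n) y <= (y == x0)%:R.
Proof.
move=> es yb; rewrite /laplacian sumrB sumr_const -/(deg e y) lerBlDr.
have -> : #|e y| = deg e y by rewrite /deg cardsE.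
apply: (@le_trans _ _ (\sum_(i < n) pr (avoid b i y))).
  rewrite -[leLHS]mulr_natr /green.
  have [->|dy] := eqVneq (deg e y) 0%N.
    by rewrite mulr0 sumr_ge0 // => i _; exact: pr_ge0.
  by rewrite divfK // pnatr_eq0.
apply: (@le_trans _ _ (\sum_(i < n.+1) pr (avoid b i y))).
  by rewrite big_ord_recr /= lerDl pr_ge0.
rewrite big_ord_recl /=; apply: lerD; first exact: pr_avoid0_le.
under eq_bigr do rewrite /bump leq0n add1n pr_avoidS //.
rewrite exchange_big /= [leRHS]big_mkcond /=; apply: ler_sum => z _.
rewrite -mulr_suml /srw_step /green es.
by case: ifP => _ //; rewrite mulr0.
Qed.

Definition crossing b n (p : V * V) : set Om :=
  avoid b n p.1 `&` [set w | X n.+1 w = p.2].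

Lemma measurable_crossing b n p : measurable (crossing b n p).
Proof. by apply: measurableI => //; exact: measurable_avoid. Qed.

Lemma sum_pr_crossing b n (c : V * V -> R) :
  \sum_(i < n) \sum_p c p * pr (crossing b i p) =
  \sum_x \sum_(y | e x y) green b n x * c (x, y).
Proof.
pose G x y := \sum_(i < n) c (x, y) * pr (crossing b i (x, y)).
rewrite exchange_big (eq_bigr (fun p => G p.1 p.2)) => [|[x y] _ //].
rewrite -(pair_bigA _ G) /G.
apply: eq_bigr => x _; rewrite [RHS]big_mkcond /=; apply: eq_bigr => y _.
under eq_bigr do rewrite pr_avoid_step mulrA.
rewrite -mulr_suml -mulr_sumr /srw_step /green.
by case: ifP => _; rewrite ?mulr0 // -mulrA mulrC.
Qed.

Lemma path_graph_sym b w : symmetric (path_graph X b w).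
Proof.
move=> x y; apply: asbool_equiv_eq.
by split=> -[i [H xy]]; exists i; split=> //; tauto.
Qed.

Lemma path_graph_crossing b w x y : path_graph X b w x y ->
  exists i, crossing b i (x, y) w \/ crossing b i (y, x) w.
Proof.
move/asboolP => [i [H xy]]; exists i.
have H' j : (j <= i)%N -> X j w != b by move=> /H /eqP.
by case: xy => -[Xi Xi1]; [left|right].
Qed.

(** Every edge of PATH is crossed in at least one direction.  The bound [n] may
depend on the outcome [w]: it is a time by which all edges of the finite graph
PATH have been crossed.  The factor [1 / 2] of the Dirichlet energy is used up
by the two orientations of an edge. *)
Lemma Ceff_path_le a b (f : V -> R) w : a != b -> f a = 1 -> f b = 0 ->
  exists n, Ceff R (path_graph X b w) a b <=
    \sum_(i < n) \sum_p (f p.1 - f p.2) ^+ 2 * \1_(crossing b i p) w.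
Proof.
move=> ab fa fb; set h := path_graph X b w.
have /choice[g gP] (p : V * V) : exists i, h p.1 p.2 ->
    crossing b i p w \/ crossing b i (p.2, p.1) w.
  case: p => x y /=; have [/path_graph_crossing[i ?]|nh] := boolP (h x y).
    by exists i.
  by exists 0%N.
exists (\max_p g p).+1; set n := (_.+1).
pose N p : R := \sum_(i < n) \1_(crossing b i p) w.
have N0 p : 0 <= N p by exact: sumr_ge0.
have N1 p i : (i < n)%N -> crossing b i p w -> 1 <= N p.
  move=> lin ci; rewrite /N (bigD1 (Ordinal lin)) //= indicE mem_set //.
  by rewrite lerDl sumr_ge0.
have hN x y : h x y -> 1 <= N (x, y) + N (y, x).
  move=> hxy; have lg : (g (x, y) < n)%N by rewrite ltnS leq_bigmax.
  case: (gP (x, y) hxy) => /= c; have := N1 _ _ lg c.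
    by move/le_trans; apply; rewrite lerDl.
  by move/le_trans; apply; rewrite lerDr.
have /andP[_ /le_trans] := Ceff_bounds (path_graph_sym b w) ab fa fb; apply.
pose c x y := (f x - f y) ^+ 2.
have -> : \sum_(i < n) \sum_p (f p.1 - f p.2) ^+ 2 * \1_(crossing b i p) w =
    \sum_x \sum_y c x y * N (x, y).
  rewrite exchange_big /= [RHS]pair_bigA /=; apply: eq_bigr => -[x y] _.
  by rewrite mulr_sumr.
rewrite -(ler_pM2l (ltr0n R 2)) mulrA divff ?pnatr_eq0 // mul1r.
(* one of the two copies is reindexed by reversing the edges *)
rewrite [leRHS]mulr_natl mulr2n [X in _ <= _ + X]exchange_big -big_split /=.
apply: ler_sum => x _; rewrite -big_split /= big_mkcond /=.
apply: ler_sum => y _; rewrite {2}/c -(opprB (f x)) sqrrN -mulrDr.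
case: ifP => hxy; last by rewrite mulr_ge0 ?sqr_ge0 ?addr_ge0.
by rewrite -[leLHS]mulr1 ler_wpM2l ?sqr_ge0 // hN.
Qed.

(** * Hitting probabilities as limits of a recursion *)

Section Hitting.
Variables a b : V.
Hypothesis ab : a != b.

(** After time [n], the walk reaches [a] within [k] steps and before [b]; the
recursion on [k] looks one step ahead. *)
Fixpoint hit k n (w : Om) : Prop :=
  if k is k'.+1 then X n w = a \/ (X n w <> b /\ hit k' n.+1 w)
  else X n w = a.

Lemma hitP k n w : hit k n w <->
  exists2 j, (j <= k)%N & X (n + j)%N w = a /\
    forall m, (m <= j)%N -> X (n + m)%N w <> b.
Proof.
have nab : a <> b by exact/eqP.
elim: k n => [|k IH] n /=.
  split=> [Xa|[j]].
    exists 0%N => //; rewrite addn0; split=> // m.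
    by rewrite leqn0 => /eqP ->; rewrite addn0 Xa.
  by rewrite leqn0 => /eqP -> []; rewrite addn0.
split=> [[Xa|[Xb /IH[j jk [Xa H]]]]|[[|j] jk [Xa H]]].
- exists 0%N => //; rewrite addn0; split=> // m.
  by rewrite leqn0 => /eqP ->; rewrite addn0 Xa.
- exists j.+1 => //; rewrite addnS -addSn; split=> // -[|m] mj.
    by rewrite addn0.
  by rewrite addnS -addSn; exact: H.
- by left; rewrite addn0 in Xa.
- right; split; first by have := H 0%N (leq0n _); rewrite addn0.
  apply/IH; exists j => //; rewrite addSn -addnS; split=> // m mj.
  by rewrite addSn -addnS; exact: H.
Qed.

Lemma measurable_hit k n : measurable [set w | hit k n w].
Proof.
elim: k n => [|k IH] n /=; first exact: mX.
apply: (measurableU [set w | X n w = a]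
  (~` [set w | X n w = b] `&` [set w | hit k n.+1 w])).
  exact: mX.
by apply: (measurableI (~` _)); [apply: measurableC; exact: mX|exact: IH].
Qed.

(** The solution of the recursion that the probabilities of [hit k 0] satisfy as
functions of the starting vertex. *)
Fixpoint reach k (x : V) : R :=
  if x == a then 1 else
  if x == b then 0 else
  if k is k'.+1 then \sum_y step x y * reach k' y else 0.

(** The induction on [k] needs an arbitrary past: after conditioning on the next
vertex [y], the history [p] is one step longer and [k] one smaller.  Stating
the Markov property this way avoids walks on different probability spaces. *)
Lemma pr_cylinder_hit k n p :
  pr (cylinder n p `&` [set w | hit k n w]) = pr (cylinder n p) * reach k (p n).
Proof.
have Xn w : cylinder n p w -> X n w = p n by exact.
elim: k n p Xn => [|k IH] n p Xn /=.
  case: eqVneq => [pa|pa].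
    by rewrite setIidl ?mulr1 // => w /Xn /= ->.
  rewrite if_same mulr0 (_ : _ `&` _ = set0) ?pr_set0 //.
  by apply/seteqP; split => // w [/Xn /= ->] /eqP; rewrite (negbTE pa).
case: eqVneq => [pa|pa].
  by rewrite setIidl ?mulr1 // => w /Xn /= ->; left.
case: eqVneq => [pb|pb].
  rewrite mulr0 (_ : _ `&` _ = set0) ?pr_set0 //.
  apply/seteqP; split => // w [/Xn /= -> []]; last by case.
  by move/eqP; rewrite (negbTE pa).
have -> : cylinder n p `&` [set w | X n w = a \/ X n w <> b /\ hit k n.+1 w] =
    cylinder n p `&` [set w | hit k n.+1 w].
  apply/seteqP; split => w [cw /=]; rewrite (Xn w cw).
    by case=> [/eqP|[]] //; rewrite (negbTE pa).
  by split=> //; right; split=> //; exact/eqP.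
have mcap : measurable (cylinder n p `&` [set w | hit k n.+1 w]).
  by apply: measurableI; [exact: measurable_cylinder|exact: measurable_hit].
rewrite (pr_fibers P (fun y => mX n.+1 y) mcap) mulr_sumr; apply: eq_bigr => y _.
rewrite setIAC.
have -> : cylinder n p `&` [set w | X n.+1 w = y] =
    cylinder n.+1 (fun i => if (i <= n)%N then p i else y).
  apply/seteqP; split => w.
    move=> [cw Xy] i; rewrite leq_eqVlt => /predU1P[->|]; first by rewrite ltnn.
    by rewrite ltnS => ilen; rewrite ilen cw.
  move=> H; split=> [i ilen|/=]; first by rewrite H ?ilen // leqW.
  by rewrite H // ltnn.
rewrite IH; last by move=> w; exact.
rewrite ltnn mulrA; congr (_ * _).
rewrite -pr_cylinder_step; congr pr; apply/seteqP; split => w.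
  move=> H; split=> [i ilen|/=]; first by rewrite H ?ilen // leqW.
  by rewrite H // ltnn.
move=> [cw Xy] i; rewrite leq_eqVlt => /predU1P[->|]; first by rewrite ltnn.
by rewrite ltnS => ilen; rewrite ilen cw.
Qed.

Lemma pr_hit k : pr [set w | hit k 0 w] = reach k x0.
Proof.
have [_ X0 _] := HX.
have c0 : cylinder 0 (fun=> x0) = [set w | X 0%N w = x0].
  apply/seteqP; split=> w /= H; first exact: H.
  by move=> i; rewrite leqn0 => /eqP ->.
rewrite -(pr_setI_full (measurable_hit k 0) (mX 0%N x0) X0) setIC -c0.
by rewrite pr_cylinder_hit c0 pr_full ?mul1r.
Qed.

Lemma hits_beforeE : hits_before X a b = \bigcup_k [set w | hit k 0 w].
Proof.
apply/seteqP; split=> [w [n [Xa H]]|w [k _ /hitP[j _ [Xa H]]]].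
  by exists n => //; apply/hitP; exists n.
by exists j.
Qed.

Lemma measurable_hits_before : measurable (hits_before X a b).
Proof.
by rewrite hits_beforeE; apply: bigcup_measurable => k _; exact: measurable_hit.
Qed.

Lemma cvg_reach : reach k x0 @[k --> \oo] --> pr (hits_before X a b).
Proof.
have nd : nondecreasing_seq (fun k => [set w | hit k 0 w]).
  move=> k l kl; apply/subsetPset => w /hitP[j jk H]; apply/hitP.
  by exists j => //; exact: leq_trans kl.
have mU := measurable_hits_before.
have Pcvg : P [set w | hit k 0 w] @[k --> \oo] --> (pr (hits_before X a b))%:E.
  rewrite -prE //; move: mU; rewrite hits_beforeE => mU.
  exact: (nondecreasing_cvg_mu (fun k => measurable_hit k 0) mU nd).
by move/fine_cvg: Pcvg; under eq_cvg do rewrite /= -/(pr _) pr_hit.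
Qed.

End Hitting.
End Walk.

(** * Expectation bound through indicators *)

Section ExpectationBound.
Context {d : measure_display} {Om : measurableType d} {R : realType}.
Variable P : probability Om R.

(** The integral of a nonnegative function is a supremum over the simple
functions below it, hence monotone without measurability. *)
Lemma le_integral_nonmeasurable (f g : Om -> \bar R) :
    (forall w, 0 <= f w)%E -> (forall w, f w <= g w)%E ->
  (\int[P]_w f w <= \int[P]_w g w)%E.
Proof.
move=> f0 fg; rewrite !ge0_integralTE //; last first.
  by move=> w; exact: le_trans (fg w).
apply: ereal_sup_le => _ [h hf <-]; exists h => // w.
exact: le_trans (hf w) (fg w).
Qed.

(** A union bound for expectations: the number of terms needed to dominate [f]
may vary with the outcome, because the whole series is integrated. *)
Lemma expectation_le_sum_indic (T : finType) (f : Om -> R) (c : T -> R)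
    (A : nat -> T -> set Om) (K : R) :
    (forall w, 0 <= f w) -> (forall t, 0 <= c t) ->
    (forall i t, measurable (A i t)) ->
    (forall w, exists n, f w <= \sum_(i < n) \sum_t c t * \1_(A i t) w) ->
    (forall n, \sum_(i < n) \sum_t c t * pr P (A i t) <= K) ->
  ('E_P[f] <= K%:E)%E.
Proof.
move=> f0 c0 mA fA AK; rewrite unlock.
pose g i w := (\sum_t (c t)%:E * (\1_(A i t) w)%:E)%E.
have mg1 i t : measurable_fun setT (EFin \o (\1_(A i t) : Om -> R)).
  by apply/measurable_EFinP; exact: measurable_indic.
have gt0 i t w : (0 <= (c t)%:E * (\1_(A i t) w)%:E :> \bar R)%E.
  by rewrite -EFinM lee_fin mulr_ge0.
have mgt i t : measurable_fun setT
    (fun w => (c t)%:E * (EFin \o (\1_(A i t) : Om -> R)) w)%E.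
  by apply: measurable_funeM.
have g0 i w : (0 <= g i w)%E by exact: sume_ge0.
have mg i : measurable_fun setT (g i).
  apply: emeasurable_sum => t; exact: mgt.
have gE i : (\int[P]_w g i w = (\sum_t c t * pr P (A i t))%:E)%E.
  rewrite (ge0_integral_sum P measurableT (mgt i) (fun t w _ => gt0 i t w)).
  rewrite -(sumEFin _ xpredT (fun t => c t * pr P (A i t))); apply: eq_bigr => t _.
  rewrite ge0_integralZl_EFin //; last by move=> w _; rewrite lee_fin.
  by rewrite /= integral_indic // setIT EFinM -(prE P (mA i t)).
apply: (@le_trans _ _ (\int[P]_w (\sum_(0 <= i <oo) g i w)%E)%E).
  apply: le_integral_nonmeasurable => w /=; first by rewrite lee_fin.
  have [n fn] := fA w.
  apply: le_trans (nneseries_lim_ge n _); last by move=> *; exact: g0.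
  rewrite big_mkord.
  apply: (@le_trans _ _ (\sum_(i < n) \sum_t c t * \1_(A i t) w)%:E).
    by rewrite lee_fin.
  by rewrite -sumEFin; apply: lee_sum => i _; rewrite -sumEFin.
rewrite integral_nneseries //.
apply: lime_le; first by apply: is_cvg_nneseries => i _ _; exact: integral_ge0.
apply: nearW => n; rewrite big_mkord.
under eq_bigr do rewrite gE.
by rewrite sumEFin lee_fin.
Qed.

End ExpectationBound.

(** * The escape probability is the unit voltage *)

Section EscapeVoltage.
Context {R : realType} {V : finType}.
Variables (e : rel V) (W : forall x : V, srw R e x) (a b : V).
Hypothesis ab : a != b.
Let v := hit_prob W a b.

Lemma cvg_reach_hit_prob x : @reach R V e a b k x @[k --> \oo] --> v x.
Proof. exact: (cvg_reach (srwP (W x)) ab). Qed.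

Lemma hit_prob_source : v a = 1.
Proof.
have c := @cvg_reach_hit_prob a.
have E k : @reach R V e a b k a = 1 by case: k => [|k] /=; rewrite eqxx.
have /cvg_lim <- // := c; under eq_fun do rewrite E.
exact: lim_cst.
Qed.

Lemma hit_prob_sink : v b = 0.
Proof.
have c := @cvg_reach_hit_prob b.
have E k : @reach R V e a b k b = 0.
  by case: k => [|k] /=; rewrite eq_sym (negbTE ab) eqxx.
have /cvg_lim <- // := c; under eq_fun do rewrite E.
exact: lim_cst.
Qed.

Lemma hit_prob_mean x : x != a -> x != b ->
  v x = \sum_y srw_step R e x y * v y.
Proof.
move=> xa xb; have c1 := @cvg_reach_hit_prob x.
have c2 : \sum_y srw_step R e x y * @reach R V e a b k y @[k --> \oo] -->
    \sum_y srw_step R e x y * v y.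
  apply: cvg_big => [|y _]; first exact: add_continuous.
  by apply: cvgMl_tmp; exact: cvg_reach_hit_prob.
move: c1; rewrite -cvg_shiftS /= (negbTE xa) (negbTE xb) => c1.
exact: cvg_unique c1 c2.
Qed.

Lemma hit_prob_ge0 x : 0 <= v x.
Proof. exact: pr_ge0. Qed.

Lemma hit_prob_le1 x : v x <= 1.
Proof. by apply: pr_le1; exact: (measurable_hits_before (srwP (W x)) ab). Qed.

Lemma hit_prob_harmonic x : x != a -> x != b -> laplacian e v x = 0.
Proof.
move=> xa xb; rewrite /laplacian sumrB sumr_const.
have -> : #|e x| = deg e x by rewrite /deg cardsE.
have dE : v x = (\sum_(y | e x y) v y) / (deg e x)%:R.
  rewrite (hit_prob_mean xa xb) mulr_suml [RHS]big_mkcond; apply: eq_bigr => y _.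
  by rewrite /srw_step; case: ifP => _; rewrite ?mul0r // mulrC.
have [d0|d0] := eqVneq (deg e x) 0%N.
  rewrite d0 mulr0n big_pred0 ?subrr // => y.
  by have /eqP := d0; rewrite /deg cardsE => /eqP/card0_eq/(_ y).
by rewrite -[_ *+ _]mulr_natr {1}dE divfK ?subrr // pnatr_eq0.
Qed.

End EscapeVoltage.

(** * The expected conductance of the path *)

Theorem theorem10 (R : realType) (V : finType) (e : rel V) (X0 Y0 : V)
    (He : simple_graph e) (Hconn : connected_graph e) (H0 : X0 != Y0)
    (W : forall x : V, srw R e x) :
  let X := @srw_walk R V e X0 (W X0) in
  let v := hit_prob W X0 Y0 in
  let s := \big[Num.max/0]_(y | e Y0 y) v y in
  let d := (\max_(x | x != Y0) deg e x)%N in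
  ('E_(srw_prob (W X0)) [fun w => Ceff R (path_graph X Y0 w) X0 Y0]
   <= if (s == 1)%R then +oo else (12 * ln (d%:R : R) / ln (1 / s))%R%:E)%E.
Proof.
rewrite /=; set X := srw_walk (s := W X0); set v := hit_prob W X0 Y0.
set s := \big[_/_]_(_ | _) _; set d := (\max_(_ | _) _)%N.
case: (eqVneq s 1) => [_|s1]; first by rewrite leey.
have [es _] := He.
have va : v X0 = 1 by exact: hit_prob_source.
have vb : v Y0 = 0 by exact: hit_prob_sink.
have v01 x : 0 <= v x <= 1 by rewrite hit_prob_ge0 hit_prob_le1.
have vh x : x != X0 -> x != Y0 -> laplacian e v x = 0.
  exact: hit_prob_harmonic.
have sP y : e Y0 y -> v y <= s by move=> ey; exact: le_bigmax_cond.
have s_ge0 : 0 <= s by exact: bigmax_ge_id.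
have s_le1 : s <= 1.
  by apply: bigmax_le => // y _; have /andP[] := v01 y.
(* if s = 0, v attains its minimum 0 at Y0 and is superharmonic off X0 *)
have s_neq0 : s != 0.
  apply/eqP => s0.
  have vsup : superharmonic_off e (pred1 X0) v.
    move=> x; rewrite inE => xa; have [->|xb] := eqVneq x Y0; last by rewrite vh.
    apply: sumr_ge0 => y ey; rewrite vb sub0r oppr_ge0.
    by rewrite -s0 sP.
  have vmin y : v Y0 <= v y by rewrite vb; have /andP[] := v01 y.
  have X0in : X0 \in pred1 X0 by rewrite inE.
  have [x] := minimum_attained Hconn X0in vsup vmin.
  by rewrite inE => /eqP ->; rewrite va vb => /eqP; rewrite oner_eq0.
have s01 : 0 < s < 1 by rewrite !lt_neqAle s_ge0 s_le1 s1 eq_sym s_neq0.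
have dP x : x != Y0 -> (deg e x <= d)%N by move=> xb; exact: leq_bigmax_cond.
pose f := log_truncation v s.
have fa : f X0 = 1 by exact: log_truncation_source.
have fb : f Y0 = 0 by exact: log_truncation_sink.
have HX := srwP (W X0).
apply: (@expectation_le_sum_indic _ _ _ _ _ _
  (fun p : V * V => (f p.1 - f p.2) ^+ 2) (crossing X Y0)).
- by move=> w; have /andP[] := Ceff_bounds (path_graph_sym X Y0 w) H0 fa fb.
- by move=> p; exact: sqr_ge0.
- by move=> i p; exact: (measurable_crossing HX).
- by move=> w; exact: Ceff_path_le.
- move=> n; rewrite (sum_pr_crossing HX) /=.
  apply: (occupation_energy_le es H0 va vb v01 vh s01 sP dP Hconn).
  + by move=> x; exact: green_ge0.
  + exact: green_sink.
  + by move=> x xb; exact: (laplacian_green HX).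
Qed.
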